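(* Let $P = (X, \leq_P)$ and $Q = (Y, \leq_Q)$ be disjoint finite posets, let $A \subseteq X$ be convex in $P$, let $B \subseteq Y$ be convex in $Q$, and let $\beta : P|_A \to Q|_B$ be an isomorphism. Let $T = (V, \leq_T)$ be the poset constructed from these data as described in the context. Then $$P + Q \; \sqsubseteq_G \; P|_A + T.$$
   Context: For a poset $P=(X,\leq)$ and $A \subseteq X$, $P|_A$ is the induced subposet on $A$. $A$ is convex in $P$ iff $x,y \in A$ and $x \leq z \leq y$ imply $z \in A$. $P_1 + P_2$ denotes the direct sum (disjoint union with no relations between the summands) of posets with disjoint carriers. For $y \in Q$, $\downarrow_Q y := \{ z \in Q : z \leq_Q y\}$ and $\uparrow_Q y := \{ z \in Q : y \leq_Q z \}$. Construction of $T$: put $W := X \setminus A$, $O := P|_W$ with partial order $\leq_O$, and $V := W \cup Y$. Define on $V$ the relation $\leq_T \; := \; \leq_O \cup \leq_Q \cup \leq_d \cup \leq_u$, where $\leq_d \; := \{ (y,w) \in Y \times W : \exists a \in A \text{ with } a \leq_P w \text{ and } y \in \downarrow_Q \beta(a) \}$, $\leq_u \; := \{ (w,y) \in W \times Y : \exists a \in A \text{ with } w \leq_P a \text{ and } y \in \uparrow_Q \beta(a) \}$. The relation $\leq_T$ is a partial order on $V$, so $T = (V,\leq_T)$ is a poset. $\mathfrak{P}_r$ is a fixed representation system of the isomorphism classes of finite posets. $\mathcal{H}(P,Q)$ is the set of order homomorphisms $\xi : P \to Q$ ($x \leq y \Rightarrow \xi(x) \leq \xi(y)$). For a subset $C$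 of a poset and $x,y \in C$, $x$ and $y$ are connected in $C$ if there are $z_0, \ldots, z_L \in C$, $L \geq 0$, with $x = z_0$, $y = z_L$ and, for each $\ell=1,\ldots,L$, $z_{\ell-1} < z_\ell$ or $z_{\ell-1} > z_\ell$; $\gamma_C(x)$ is the set of $y \in C$ connected with $x$ in $C$. For a homomorphism $\xi$ defined on a poset and a point $x$ of it, $G_\xi(x) := \gamma_{\xi^{-1}(\{\xi(x)\})}(x)$. A Hom-scheme from a finite poset $R$ to a finite poset $S$ is a family $\rho = (\rho_M)_{M \in \mathfrak{P}_r}$ of maps $\rho_M : \mathcal{H}(M,R) \to \mathcal{H}(M,S)$. It is strong if every $\rho_M$ is injective. It is a G-scheme if $G_{\rho_M(\xi)}(x) = G_\xi(x)$ for all $M \in \mathfrak{P}_r$, $\xi \in \mathcal{H}(M,R)$, $x \in M$. We write $R \sqsubseteq_G S$ iff a strong G-scheme from $R$ to $S$ exists. *)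

(* Defs.v *)
From HB Require Import structures.
From mathcomp Require Import all_boot all_order.

Set Implicit Arguments.
Unset Strict Implicit.
Unset Printing Implicit Defensive.

Import Order.TTheory.
Local Open Scope order_scope.

(* Carriers may be empty.  The displays of the posets built below are only     *)
(* notational tags; they carry no order-theoretic content.                     *)

Definition convex d (P : porderType d) (A : {pred P}) : Prop :=
  forall x y z : P, x \in A -> y \in A -> x <= z -> z <= y -> z \in A.

Definition order_iso d d' (P : porderType d) (Q : porderType d') (f : P -> Q) :
    Prop :=
  bijective f /\ {mono f : x y / x <= y}.

Definition isomorphic d d' (P : porderType d) (Q : porderType d') : Prop :=
  exists f : P -> Q, order_iso f.

Section Induced.
Context {d : Order.disp_t} {P : finPOrderType d}.

Definition induced (A : {set P}) : Type := {x : P | x \in A}.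

Variable A : {set P}.
HB.instance Definition _ := SubFinite.on (induced A).
HB.instance Definition _ :=
  [SubChoice_isSubPOrder of induced A by <: with d].
End Induced.

Section DirectSum.
Context {d d' : Order.disp_t}.

Definition dsum (P : finPOrderType d) (Q : finPOrderType d') : Type :=
  (P + Q)%type.

Variables (P : finPOrderType d) (Q : finPOrderType d').

Definition dsum_le : rel (dsum P Q) := fun u v =>
  match u, v with
  | inl x, inl x' => x <= x'
  | inr y, inr y' => y <= y'
  | _, _ => false
  end.

Fact dsum_le_refl : reflexive dsum_le.
Proof. by case=> x /=. Qed.

Fact dsum_le_anti : antisymmetric dsum_le.
Proof. by case=> x [] y //= /le_anti ->. Qed.

Fact dsum_le_trans : transitive dsum_le.
Proof. by case=> y [] x [] z //=; apply: le_trans. Qed.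

HB.instance Definition _ := Finite.on (dsum P Q).
HB.instance Definition _ := Order.Le_isPOrder.Build d (dsum P Q)
  dsum_le_refl dsum_le_anti dsum_le_trans.
End DirectSum.

Section Gluing.
Context {d d' : Order.disp_t} {P : finPOrderType d} {Q : finPOrderType d'}.
Context {A : {set P}} {B : {set Q}} {beta : induced A -> induced B}.

(* The poset T on V = (X \ A) U Y, with order glue_le.  The hypotheses occur   *)
(* as arguments because they are what makes glue_le a partial order.           *)
Definition glue (convA : convex A) (convB : convex B)
    (iso_beta : order_iso beta) : Type :=
  (induced (~: A) + Q)%type.

Variables (convA : convex A) (convB : convex B) (iso_beta : order_iso beta).

Definition glue_le : rel (glue convA convB iso_beta) := fun u v =>
  match u, v with
  | inl w, inl w' => w <= w'
  | inr y, inr y' => y <= y'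
  | inr y, inl w =>
      [exists a : induced A, (val a <= val w) && (y <= val (beta a))]
  | inl w, inr y =>
      [exists a : induced A, (val w <= val a) && (val (beta a) <= y)]
  end.

Fact glue_le_refl : reflexive glue_le.
Proof. by case=> x /=. Qed.

Let notA (w : induced (~: A)) : val w \in A -> False.
Proof. by move=> wA; have := valP w; rewrite inE wA. Qed.

Let beta_le a a' : (val (beta a) <= val (beta a')) = (val a <= val a').
Proof. by have := iso_beta.2 a a'; rewrite !Order.le_val. Qed.

Let le_du (y y' : Q) (w : induced (~: A)) :
  glue_le (inr y) (inl w) -> glue_le (inl w) (inr y') -> False.
Proof.
move=> /= /existsP[a /andP[aw _]] /existsP[a' /andP[wa' _]].
exact: notA (convA (valP a) (valP a') aw wa').
Qed.

Fact glue_le_anti : antisymmetric glue_le.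
Proof.
case=> x [] y; first by move=> /= /le_anti ->.
- by move=> /andP[xy yx]; case: (le_du yx xy).
- by move=> /andP[xy yx]; case: (le_du xy yx).
- by move=> /= /le_anti ->.
Qed.

Fact glue_le_trans : transitive glue_le.
Proof.
case=> y [] x [] z.
- exact: le_trans.
- move=> /= xy /existsP[a /andP[ya az]]; apply/existsP; exists a.
  by rewrite az (le_trans _ ya) // Order.le_val.
- move=> /= /existsP[a /andP[ay xa]] yz; apply/existsP; exists a.
  by rewrite xa (le_trans ay) // Order.le_val.
- by move=> xy /(le_du xy).
- move=> /= /existsP[a /andP[xa ay]] /existsP[a' /andP[a'z ya']].
  rewrite -Order.le_val (le_trans xa) // (le_trans _ a'z) // -beta_le.
  exact: le_trans ay ya'.
- move=> /= /existsP[a /andP[xa ay]] yz; apply/existsP; exists a.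
  by rewrite xa (le_trans ay).
- move=> /= xy /existsP[a /andP[az ya]]; apply/existsP; exists a.
  by rewrite az (le_trans xy).
- exact: le_trans.
Qed.

HB.instance Definition _ := Finite.on (glue convA convB iso_beta).
HB.instance Definition _ := Order.Le_isPOrder.Build d' (glue convA convB iso_beta)
  glue_le_refl glue_le_anti glue_le_trans.
End Gluing.

(* A representation system of the isomorphism classes of finite posets: every  *)
(* finite poset, whatever its display, is isomorphic to exactly one member.    *)
Record repr_system (d : Order.disp_t) := ReprSystem {
  rs_index : Type;
  rs_poset : rs_index -> finPOrderType d;
  rs_cover : forall d' (R : finPOrderType d'),
    exists i, isomorphic R (rs_poset i);
  rs_uniq : forall i j, isomorphic (rs_poset i) (rs_poset j) -> i = j
}.

Section Components.
Context {d : Order.disp_t} {M : finPOrderType d}.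

Definition step_in (C : {set M}) : rel M :=
  [rel u v | [&& u \in C, v \in C & (u < v) || (v < u)]].

(* For x \in C this is gamma_C(x); connect is the reflexive transitive closure *)
(* of a step relation that keeps the whole path inside C.                      *)
Definition component (C : {set M}) (x : M) : {set M} :=
  [set y in C | connect (step_in C) x y].

(* G_xi(x) *)
Definition fiber_component d' (R : finPOrderType d') (xi : M -> R) (x : M) :
    {set M} :=
  component [set y | xi y == xi x] x.
End Components.

Section HomSchemes.
Context {d dR dS : Order.disp_t}.
Variable Pr : repr_system d.
Variables (R : finPOrderType dR) (S : finPOrderType dS).

Definition hom_scheme : Type :=
  forall i : rs_index Pr,
    {omorphism rs_poset i -> R} -> {omorphism rs_poset i -> S}.

Definition strong (rho : hom_scheme) : Prop := forall i, injective (rho i).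

Definition G_scheme (rho : hom_scheme) : Prop :=
  forall i (xi : {omorphism rs_poset i -> R}) (x : rs_poset i),
    fiber_component (rho i xi) x = fiber_component xi x.

Definition G_le : Prop :=
  exists rho : hom_scheme, strong rho /\ G_scheme rho.
End HomSchemes.

(* Main.v *)
Require Import Defs.
From mathcomp Require Import all_boot all_order.
From HB Require Import structures.
From mathcomp Require Import boolp.

(** Why [P + Q] is below [P|_A + T].  The poset [T] contains a copy of [P]: keep
    the points of [W = X \ A] and send [a] in [A] to [beta a]; it also contains
    [Q] itself.  Both maps are injective homomorphisms, but their images overlap
    in [B], so they cannot be used together without losing injectivity.  The
    summand [P|_A] absorbs exactly this overlap.

    Given a homomorphism [xi : M -> P + Q], every connected component of [M] is
    sent into one summand.  A component sent into [Q] is left there.  A component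
    sent into [P] that meets [W] is transported into [T] by the copy of [P]; a
    component sent into [A] is sent into the summand [P|_A].  Monotonicity only
    concerns points of one component, and on each of them [xi] is composed with
    one monotone map ([relocate_homo]).

    That map is also injective on the summand in question
    ([relocate_inj_left]), so on a component of [M] the new homomorphism has
    the same fibers as [xi].  The set [G_xi(x)] is found by walking inside a
    fiber, hence inside one component, and is therefore unchanged
    ([fiber_component_eq]).

    For injectivity, the new homomorphism reveals the treatment of each
    component: points of [W] are never moved, so the components that reach [W]
    are the ones that meet [W] in the image ([reaches_scheme_map]).  An
    ambiguity is then possible only for a point of [B] that could come from [A]
    or from [Q]; but in the first case its component has a point in [W], which
    cannot happen in the second ([scheme_map_inj]). *)

Set Implicit Arguments.
Unset Strict Implicit.
Unset Printing Implicit Defensive.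

Import Order.TTheory.
Local Open Scope order_scope.

(** * Connectedness and fibers *)

Section Linked.
Context {d : Order.disp_t} {M : finPOrderType d}.

(** Connectedness in the whole poset.  Reflexive comparability is used as the
    step: it has the same closure as strict comparability. *)
Definition linked : rel M := connect (fun x y => x >=< y).

Lemma linked_sym : symmetric linked.
Proof.
by apply: sym_connect_sym => x y; rewrite comparable_sym.
Qed.

Lemma le_linked (x y : M) : x <= y -> linked x y.
Proof. by move=> xy; apply: connect1; rewrite /Order.comparable xy. Qed.

Lemma linked_invariant (T : eqType) (f : M -> T) :
  {homo f : x y / x <= y >-> x = y} -> forall x y, linked x y -> f x = f y.
Proof.
move=> fE x y /connectP[p]; elim: p x => [|z p IHp] x /=; first by move=> _ ->.
by case/andP=> /orP[/fE->|/fE<-]; apply: IHp.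
Qed.

(** A walk inside a fiber of [f] takes steps between comparable points that [f]
    identifies, so [g] is constant along it too. *)
Lemma fiber_component_sub d1 d2 (R : finPOrderType d1) (S : finPOrderType d2)
    (f : M -> R) (g : M -> S) :
    (forall x y, x <= y -> f x = f y -> g x = g y) ->
  forall x, fiber_component f x \subset fiber_component g x.
Proof.
move=> fg x; apply/subsetP=> y; rewrite !inE => /andP[_ /connectP[p]].
set e := step_in [set z | g z == g x].
suff walk u : g u = g x -> connect e x u ->
    path (step_in [set z | f z == f x]) u p -> y = last u p ->
    (g y == g x) && connect e x y.
  exact: walk.
elim: p u => [|v p IHp] u gu xu /=; first by move=> _ ->; rewrite gu eqxx.
case/andP=> /and3P[/[!inE]/eqP fu /eqP fv uv].
have gv : g v = g x.
  by rewrite -gu; case/orP: uv => /ltW/fg ->; rewrite ?fu ?fv.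
apply: IHp => //; apply: connect_trans xu (connect1 _).
by rewrite /e /step_in /= !inE gu gv eqxx.
Qed.

Lemma fiber_component_eq d1 d2 (R : finPOrderType d1) (S : finPOrderType d2)
    (f : M -> R) (g : M -> S) :
    (forall x y, x <= y -> f x = f y <-> g x = g y) ->
  fiber_component f =1 fiber_component g.
Proof.
move=> fgE x; apply/eqP; rewrite eqEsubset.
by rewrite !fiber_component_sub // => u v /fgE[].
Qed.

End Linked.

Lemma omorph_ext d d' (M : porderType d) (R : porderType d')
    (f g : {omorphism M -> R}) : f =1 g -> f = g.
Proof.
case: f g => f [[fP]] [g [[gP]]] /= /funext fg.
by case: _ / fg in gP *; rewrite (Prop_irrelevance fP gP).
Qed.

(** * Splitting a poset along a subset *)

Section Split.
Context {d : Order.disp_t} {P : finPOrderType d} {A : {set P}}.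

Definition split_mem (p : P) : induced A + induced (~: A) :=
  match decP (@idP (p \in A)) with
  | left pA => inl (exist _ p pA)
  | right pA => inr (exist _ p (introT setCP pA))
  end.

Variant split_mem_spec : P -> induced A + induced (~: A) -> bool -> Type :=
  | SplitIn (a : induced A) : split_mem_spec (val a) (inl a) true
  | SplitOut (w : induced (~: A)) : split_mem_spec (val w) (inr w) false.

Lemma split_memP p : split_mem_spec p (split_mem p) (p \in A).
Proof.
rewrite /split_mem; case: decP => pA.
  by have := SplitIn (exist _ p pA); rewrite /= pA.
have := SplitOut (exist _ p (introT setCP pA)).
by rewrite -[false](introF idP pA).
Qed.

End Split.

(** * Relocating one point *)

Section Scheme.
Context {dP dQ : Order.disp_t} {P : finPOrderType dP} {Q : finPOrderType dQ}.
Context {A : {set P}} {B : {set Q}} {convA : convex A} {convB : convex B}.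
Context {beta : induced A -> induced B} {iso_beta : order_iso beta}.

Local Notation T := (glue convA convB iso_beta).
Local Notation source := (dsum P Q).
Local Notation target := (dsum (induced A) T).

Definition in_left (u : source) : bool := if u is inl _ then true else false.

Definition in_W (u : source) : bool := if u is inl p then p \notin A else false.

Definition in_W_target (v : target) : bool :=
  if v is inr (inl _) then true else false.

(** The flag says whether the component of the point reaches [W], that is,
    whether a point of [A] has to be carried along into [T]. *)
Definition relocate (b : bool) (u : source) : target :=
  match u with
  | inl p => match split_mem p with
             | inl a => if b then inr (inr (val (beta a)) : T) else inl a
             | inr w => inr (inl w : T)
             end
  | inr q => inr (inr q : T)
  end.

Lemma in_left_homo (u v : source) : u <= v -> in_left u = in_left v.
Proof. by case: u v => x [y|y]. Qed.

Lemma in_W_left (u : source) : in_W u -> in_left u.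
Proof. by case: u. Qed.

Lemma in_W_relocate b (u : source) : in_W_target (relocate b u) = in_W u.
Proof. by case: u => [p|q] //=; case: split_memP => // a; case: b. Qed.

Lemma beta_le (a a' : induced A) :
  (val (beta a) <= val (beta a')) = (val a <= val a').
Proof. by have := iso_beta.2 a a'; rewrite !Order.le_val. Qed.

Lemma relocate_homo b (u v : source) :
  in_W u || in_W v ==> b -> u <= v -> relocate b u <= relocate b v.
Proof.
case: u v => [p|q] [p'|q'] //=; case: split_memP; case: split_memP => //=.
- move=> a' a _ aa'; case: b; last by change (a <= a'); rewrite -Order.le_val.
  by change (val (beta a) <= val (beta a')); rewrite beta_le.
- move=> w a -> aw; apply/existsP; exists a.
  by rewrite lexx andbT.
- move=> a w -> wa; apply/existsP; exists a.
  by rewrite lexx andbT.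
Qed.

Lemma relocate_inj_left b (u v : source) :
  in_left u = in_left v -> relocate b u = relocate b v -> u = v.
Proof.
case: u v => [p|q] [p'|q'] //= _; last by case=> ->.
case: split_memP => [a|w]; case: split_memP => [a'|w'] //; case: b => //.
- by case=> /val_inj /(bij_inj iso_beta.1) ->.
- by case=> ->.
- by case=> ->.
- by case=> ->.
Qed.

(** A point of [B] is the only value with two possible origins, and one of them
    requires the flag. *)
Lemma relocate_ambiguous b (u v : source) :
  in_left u -> ~~ in_left v -> relocate b u = relocate b v -> b.
Proof.
by case: u v => [p|q] [p'|q'] //= _ _; case: split_memP => // a; case: b.
Qed.

(** * Relocating a homomorphism *)

Section Map.
Context {d : Order.disp_t} {M : finPOrderType d}.
Implicit Type xi : {omorphism M -> source}.

Definition reaches_W xi (x : M) : bool := [exists y, linked x y && in_W (xi y)].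

Definition scheme_map xi (x : M) : target := relocate (reaches_W xi x) (xi x).

Lemma in_left_linked xi x y : linked x y -> in_left (xi x) = in_left (xi y).
Proof.
apply: (linked_invariant (f := fun z => in_left (xi z))) => {x y} x y xy.
exact/in_left_homo/omorph_le.
Qed.

Lemma reaches_W_le xi x y : x <= y -> reaches_W xi x = reaches_W xi y.
Proof.
move=> xy; apply: eq_existsb => z.
by rewrite /linked (same_connect linked_sym (le_linked xy)).
Qed.

Lemma in_W_reaches xi x : in_W (xi x) -> reaches_W xi x.
Proof. by move=> Wx; apply/existsP; exists x; rewrite Wx /linked connect0. Qed.

Lemma scheme_map_homo xi : {homo scheme_map xi : x y / x <= y}.
Proof.
move=> x y xy; rewrite /scheme_map (reaches_W_le xi xy).
apply: relocate_homo; last exact: omorph_le.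
by apply/implyP=> /orP[/in_W_reaches|/in_W_reaches //]; rewrite (reaches_W_le xi xy).
Qed.

HB.instance Definition _ xi :=
  Order.isOrderMorphism.Build d M _ target (scheme_map xi) (@scheme_map_homo xi).

Lemma fiber_component_scheme_map xi :
  fiber_component (scheme_map xi) =1 fiber_component xi.
Proof.
apply: fiber_component_eq => x y xy; rewrite /scheme_map (reaches_W_le xi xy).
split=> [|-> //]; apply: relocate_inj_left.
exact/in_left_homo/omorph_le.
Qed.

(** Points of [W] are fixed and no other point is sent there, so the flag can
    be recovered from the image. *)
Lemma reaches_scheme_map xi x :
  reaches_W xi x = [exists y, linked x y && in_W_target (scheme_map xi y)].
Proof. by apply: eq_existsb => y; rewrite in_W_relocate. Qed.

Lemma scheme_map_inj_left xi xi' x :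
    scheme_map xi =1 scheme_map xi' ->
  in_left (xi x) -> in_left (xi' x).
Proof.
move=> E left_x; apply: contraT => right_x.
have flagE y : reaches_W xi y = reaches_W xi' y.
  by rewrite !reaches_scheme_map; apply: eq_existsb => z; rewrite E.
have := E x; rewrite /scheme_map -flagE => /(relocate_ambiguous left_x right_x).
(* the component of [x] meets [W], so [xi'] cannot send it into [Q] *)
rewrite flagE => /existsP[y /andP[xy /in_W_left]].
by rewrite -(in_left_linked xi' xy) (negPf right_x).
Qed.

Lemma scheme_map_inj xi xi' : scheme_map xi =1 scheme_map xi' -> xi =1 xi'.
Proof.
move=> E x; have E' y : scheme_map xi' y = scheme_map xi y by rewrite E.
have := E x; rewrite /scheme_map !reaches_scheme_map.
under [X in relocate X (xi x)]eq_existsb do rewrite E.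
apply: relocate_inj_left.
by apply/idP/idP; apply: scheme_map_inj_left.
Qed.

End Map.
End Scheme.

Theorem theorem3 (d dP dQ : Order.disp_t) (Pr : repr_system d)
    (P : finPOrderType dP) (Q : finPOrderType dQ)
    (A : {set P}) (B : {set Q}) (convA : convex A) (convB : convex B)
    (beta : induced A -> induced B) (iso_beta : order_iso beta) :
  G_le Pr (dsum P Q) (dsum (induced A) (glue convA convB iso_beta)).
Proof.
exists (fun i (xi : {omorphism rs_poset i -> dsum P Q}) => scheme_map xi
  : {omorphism _ -> dsum (induced A) (glue convA convB iso_beta)}); split.
  move=> i xi xi' E; apply: omorph_ext.
  apply: (scheme_map_inj (iso_beta := iso_beta)) => x.
  exact: (congr1 (fun f : {omorphism _ -> _} => f x) E).
by move=> i xi x; apply: fiber_component_scheme_map.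
Qed.
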